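(* Let $\mathbb{F}$ be a field not of characteristic two and let $k$ be an integer which is non-zero in $\mathbb{F}$. In $(\mathbb{P}^1,q_k)$ over $\mathbb{F}$, if $u$ is a non-null projective point with $s_k(u)=s$, then for any natural number $n$, $$s_k(u^n)=S_n(s).$$
   Context: The projective line $\mathbb{P}^1$ over $\mathbb{F}$ consists of projective points (p-points) $[x:y]$ with $(x,y)\in\mathbb{F}^2$, $(x,y)\ne(0,0)$, where $[x_1:y_1]=[x_2:y_2]$ precisely when $x_1y_2-x_2y_1=0$. With respect to the bilinear form $[x_1,y_1]\cdot[x_2,y_2]=x_1x_2+ky_1y_2$, a p-point $[x:y]$ is null precisely when $x^2+ky^2=0$. The projective quadrance between non-null p-points $u_1=[x_1:y_1]$ and $u_2=[x_2:y_2]$ is $$q_k(u_1,u_2)=1-\frac{(x_1x_2+ky_1y_2)^2}{(x_1^2+ky_1^2)(x_2^2+ky_2^2)}=\frac{k(x_1y_2-x_2y_1)^2}{(x_1^2+ky_1^2)(x_2^2+ky_2^2)}.$$ The non-null p-points form a commutative group under the $k$-product $[a:b][c:d]=[ac-kbd:ad+bc]$, with identity $e=[1:0]$ and inverse $[a:b]^{-1}=[a:-b]$; $u^n=uu\cdots u$ ($n$ times) denotes the $n$-th power of $u$ in this group. The $k$-spread of a non-null p-point $u=[a:b]$ is $s_k(u)=q_k(e,u)=\dfrac{kb^2}{a^2+kb^2}$. The spread polynomials are defined recursively over $\mathbb{F}$ by $S_0(s)=0$, $S_1(s)=s$, and $S_n(s)=2(1-2s)S_{n-1}(s)-S_{n-2}(s)+2s$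 for $n\ge2$. *)

(* Defs.v *)
From HB Require Import structures.
From mathcomp Require Import all_boot all_algebra.
From mathcomp Require Import ring.

Set Implicit Arguments.
Unset Strict Implicit.
Unset Printing Implicit Defensive.

Import GRing.Theory.

Local Open Scope quotient_scope.
Local Open Scope ring_scope.

Section ProjectiveLine.
Variable F : fieldType.

Definition nzpair : Type := {p : F * F | p != 0}.
HB.instance Definition _ := Choice.copy nzpair {p : F * F | p != 0}.

Definition cross (p q : F * F) : F := p.1 * q.2 - q.1 * p.2.

(* [x1 : y1] = [x2 : y2] iff x1 y2 - x2 y1 = 0. *)
Definition proj_eq : rel nzpair := fun p q => cross (val p) (val q) == 0.

Lemma proj_eq_refl : reflexive proj_eq.
Proof. by move=> p; rewrite /proj_eq /cross subrr. Qed.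

Lemma proj_eq_sym : symmetric proj_eq.
Proof. by move=> p q; rewrite /proj_eq /cross -oppr_eq0 opprB. Qed.

Lemma proj_eq_trans : transitive proj_eq.
Proof.
move=> [[b1 b2] /= nb] [[a1 a2] /= na] [[c1 c2] /= nc].
rewrite /proj_eq /cross /= => /eqP ab /eqP bc; apply/eqP.
have e1 : b1 * (a1 * c2 - c1 * a2) = 0.
  transitivity (a1 * (b1 * c2 - c1 * b2) + c1 * (a1 * b2 - b1 * a2)); first by ring.
  by rewrite ab bc !mulr0 addr0.
have e2 : b2 * (a1 * c2 - c1 * a2) = 0.
  transitivity (a2 * (b1 * c2 - c1 * b2) + c2 * (a1 * b2 - b1 * a2)); first by ring.
  by rewrite ab bc !mulr0 addr0.
apply/eqP; apply: contraNT nb => nd; apply/eqP.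
move/eqP: e1; rewrite mulf_eq0 (negPf nd) orbF => /eqP ->.
by move/eqP: e2; rewrite mulf_eq0 (negPf nd) orbF => /eqP ->.
Qed.

Canonical proj_equiv := EquivRel proj_eq proj_eq_refl proj_eq_sym proj_eq_trans.

Definition ppoint : Type := {eq_quot proj_equiv}.
HB.instance Definition _ := Choice.copy ppoint {eq_quot proj_equiv}.
HB.instance Definition _ := EqQuotient.copy ppoint {eq_quot proj_equiv}.

Lemma eq_ppointE (p q : nzpair) :
  (\pi_ppoint p == \pi_ppoint q) = (cross (val p) (val q) == 0).
Proof. by rewrite piE. Qed.

End ProjectiveLine.

Section Quadrance.
Variables (F : fieldType) (k : int).
Implicit Types p q : F * F.

(* The integer k acts on F through its image k%:~R. *)
Definition kdot p q : F := p.1 * q.1 + k%:~R * p.2 * q.2.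

(* Product of p.1 + p.2 i and q.1 + q.2 i for i ^+ 2 = - k. *)
Definition kmul p q : F * F :=
  (p.1 * q.1 - k%:~R * p.2 * q.2, p.1 * q.2 + p.2 * q.1).

Lemma kdot0 : kdot 0 0 = 0.
Proof. by rewrite /kdot !mulr0 addr0. Qed.

Lemma kdot_neq0 p : kdot p p != 0 -> p != 0.
Proof. by apply: contraNneq => ->; rewrite kdot0. Qed.

Lemma kdot_kmul p q :
  kdot (kmul p q) (kmul p q) = kdot p p * kdot q q.
Proof. by case: p q => [a b] [c d]; rewrite /kdot /kmul /=; ring. Qed.

Lemma kmul_nonnull p q : kdot p p != 0 -> kdot q q != 0 ->
  kdot (kmul p q) (kmul p q) != 0.
Proof. by move=> np nq; rewrite kdot_kmul mulf_neq0. Qed.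

Lemma kconj_nonnull p : kdot p p != 0 -> kdot (p.1, - p.2) (p.1, - p.2) != 0.
Proof. by rewrite /kdot /= !mulrN mulNr opprK. Qed.

Lemma kone_nonnull : kdot (1, 0) (1, 0) != 0.
Proof. by rewrite /kdot /= !mulr0 mulr1 addr0 oner_neq0. Qed.

Lemma cross_scale p q : p != 0 -> q != 0 -> cross p q = 0 ->
  exists2 c, c != 0 & q = (c * p.1, c * p.2).
Proof.
case: p q => [a b] [c d] np nq; rewrite /cross /= => /eqP; rewrite subr_eq0 => /eqP E.
have [a0|an0] := eqVneq a 0.
  have bn0 : b != 0 by apply: contraNneq np => b0; rewrite a0 b0.
  have c0 : c = 0.
    by apply/eqP; move/eqP: E; rewrite a0 mul0r eq_sym mulf_eq0 (negPf bn0) orbF.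
  exists (d / b); last by rewrite a0 c0 mulr0 divfK.
  by rewrite mulf_neq0 ?invr_eq0 //; apply: contraNneq nq => d0; rewrite c0 d0.
exists (c / a).
  rewrite mulf_neq0 ?invr_eq0 //; apply: contraNneq nq => c0.
  by move/eqP: E; rewrite c0 mul0r mulf_eq0 (negPf an0) /= => /eqP ->.
by rewrite divfK // mulrAC -E mulrAC mulfV // mul1r.
Qed.

(* [nonnull] and [coords] go through the canonical representative of the class;
   [nonnull_pi], [quadrance_mk], [nnpoint_mulE] and [nnpoint_invE] show that
   nothing depends on this choice. *)
Definition nonnull (u : ppoint F) : bool :=
  kdot (val (repr u)) (val (repr u)) != 0.

Lemma nonnull_pi (p : nzpair F) :
  nonnull (\pi_(ppoint F) p) = (kdot (val p) (val p) != 0).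
Proof.
rewrite /nonnull; case: piP => q /eqP.
rewrite eq_ppointE => /eqP E.
have [c nc ->] := cross_scale (valP p) (valP q) E.
have -> : kdot (c * (val p).1, c * (val p).2) (c * (val p).1, c * (val p).2)
  = c ^+ 2 * kdot (val p) (val p) by rewrite /kdot /=; ring.
by rewrite mulf_eq0 expf_eq0 /= (negPf nc).
Qed.

Definition nnpoint : Type := {u : ppoint F | nonnull u}.
HB.instance Definition _ := Choice.copy nnpoint {u : ppoint F | nonnull u}.

Definition mk_ppoint p (np : kdot p p != 0) : ppoint F :=
  \pi_(ppoint F) (exist _ p (kdot_neq0 np)).

Lemma mk_ppoint_nonnull p (np : kdot p p != 0) : nonnull (mk_ppoint np).
Proof. by rewrite nonnull_pi. Qed.

Definition mk_nnpoint p (np : kdot p p != 0) : nnpoint :=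
  exist _ (mk_ppoint np) (mk_ppoint_nonnull np).

Definition coords (u : nnpoint) : F * F := val (repr (val u)).

Lemma coords_nonnull (u : nnpoint) : kdot (coords u) (coords u) != 0.
Proof. exact: valP u. Qed.

Lemma mk_nnpoint_eq p np q nq :
  (@mk_nnpoint p np = @mk_nnpoint q nq) <-> cross p q = 0.
Proof.
split=> [/(congr1 val) /= /eqP|E]; first by rewrite eq_ppointE => /eqP.
by apply: val_inj; apply/eqP; rewrite /= eq_ppointE; apply/eqP.
Qed.

Lemma coordsK (u : nnpoint) : mk_nnpoint (coords_nonnull u) = u.
Proof.
apply: val_inj => /=; rewrite -[RHS]reprK; congr (\pi_(ppoint F) _).
exact: val_inj.
Qed.

Lemma coords_mk p (np : kdot p p != 0) :
  exists2 c, c != 0 & coords (mk_nnpoint np) = (c * p.1, c * p.2).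
Proof.
have /mk_nnpoint_eq E := esym (coordsK (mk_nnpoint np)).
exact: cross_scale (kdot_neq0 np) (kdot_neq0 (coords_nonnull _)) E.
Qed.

Definition quadrance (u v : nnpoint) : F :=
  1 - kdot (coords u) (coords v) ^+ 2 /
      (kdot (coords u) (coords u) * kdot (coords v) (coords v)).

Lemma quadrance_mk p np q nq :
  quadrance (@mk_nnpoint p np) (@mk_nnpoint q nq) =
  1 - kdot p q ^+ 2 / (kdot p p * kdot q q).
Proof.
rewrite /quadrance.
have [c nc ->] := coords_mk np; have [d nd ->] := coords_mk nq.
move: np nq; rewrite /kdot /= => np nq; congr (1 - _).
have -> : (c * p.1 * (d * q.1) + k%:~R * (c * p.2) * (d * q.2)) ^+ 2 =
  (c ^+ 2 * d ^+ 2) * (p.1 * q.1 + k%:~R * p.2 * q.2) ^+ 2 by ring.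
have -> : (c * p.1 * (c * p.1) + k%:~R * (c * p.2) * (c * p.2)) *
   (d * q.1 * (d * q.1) + k%:~R * (d * q.2) * (d * q.2)) =
  (c ^+ 2 * d ^+ 2) * ((p.1 * p.1 + k%:~R * p.2 * p.2) *
     (q.1 * q.1 + k%:~R * q.2 * q.2)) by ring.
by rewrite -mulf_div divff ?mul1r // mulf_neq0 ?expf_neq0.
Qed.

Lemma quadranceE p np q nq :
  quadrance (@mk_nnpoint p np) (@mk_nnpoint q nq) =
  k%:~R * cross p q ^+ 2 / (kdot p p * kdot q q).
Proof.
rewrite quadrance_mk; apply: (mulIf (mulf_neq0 np nq)).
rewrite mulrBl !divfK ?mulf_neq0 //.
by rewrite /kdot /cross; ring.
Qed.

Definition nnpoint_mul (u v : nnpoint) : nnpoint :=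
  mk_nnpoint (kmul_nonnull (coords_nonnull u) (coords_nonnull v)).

Definition nnpoint_inv (u : nnpoint) : nnpoint :=
  mk_nnpoint (kconj_nonnull (coords_nonnull u)).

Definition nnpoint_one : nnpoint := mk_nnpoint kone_nonnull.

Lemma nnpoint_mulE p np q nq :
  nnpoint_mul (@mk_nnpoint p np) (@mk_nnpoint q nq) =
  mk_nnpoint (kmul_nonnull np nq).
Proof.
apply/mk_nnpoint_eq.
have [c nc ->] := coords_mk np; have [d nd ->] := coords_mk nq.
by rewrite /cross /kmul /=; ring.
Qed.

Lemma nnpoint_invE p np :
  nnpoint_inv (@mk_nnpoint p np) = mk_nnpoint (kconj_nonnull np).
Proof.
apply/mk_nnpoint_eq; have [c nc ->] := coords_mk np.
by rewrite /cross /=; ring.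
Qed.

Lemma nnpoint_mulC : commutative nnpoint_mul.
Proof. by move=> u v; apply/mk_nnpoint_eq; rewrite /cross /kmul /=; ring. Qed.

Lemma nnpoint_mulA : associative nnpoint_mul.
Proof.
move=> u v w; rewrite -[u]coordsK -[v]coordsK -[w]coordsK !nnpoint_mulE.
by apply/mk_nnpoint_eq; rewrite /cross /kmul /=; ring.
Qed.

Lemma nnpoint_mul1 : left_id nnpoint_one nnpoint_mul.
Proof.
move=> u; rewrite -[u]coordsK nnpoint_mulE.
by apply/mk_nnpoint_eq; rewrite /cross /kmul /=; ring.
Qed.

Lemma nnpoint_mulr1 : right_id nnpoint_one nnpoint_mul.
Proof. by move=> u; rewrite nnpoint_mulC nnpoint_mul1. Qed.

Lemma nnpoint_mulV : left_inverse nnpoint_one nnpoint_inv nnpoint_mul.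
Proof.
move=> u; rewrite -[u]coordsK nnpoint_invE nnpoint_mulE.
by apply/mk_nnpoint_eq; rewrite /cross /kmul /=; ring.
Qed.

Lemma nnpoint_mulrV : right_inverse nnpoint_one nnpoint_inv nnpoint_mul.
Proof. by move=> u; rewrite nnpoint_mulC nnpoint_mulV. Qed.

(* The powers u ^+ n (in group_scope) are those of this instance. *)
HB.instance Definition _ := isGroup.Build nnpoint
  nnpoint_mulA nnpoint_mul1 nnpoint_mulr1 nnpoint_mulV nnpoint_mulrV.

Definition kspread (u : nnpoint) : F := quadrance 1%g u.

Lemma kspreadE a b (np : kdot (a, b) (a, b) != 0) :
  kspread (mk_nnpoint np) = k%:~R * b ^+ 2 / (a ^+ 2 + k%:~R * b ^+ 2).
Proof.
rewrite /kspread [LHS]quadranceE /cross /kdot /=; congr (_ / _); ring.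
Qed.

End Quadrance.

Fixpoint spread_poly (F : fieldType) (n : nat) : {poly F} :=
  match n with
  | 0%N => 0
  | 1%N => 'X
  | (m.+1 as n1).+1 =>
      2 * (1 - 2 * 'X) * spread_poly F n1 - spread_poly F m + 2 * 'X
  end.

(* Main.v *)
Require Import Defs.
From mathcomp Require Import all_boot all_algebra.
From mathcomp Require Import ring.

Import GRing.Theory.
Local Open Scope ring_scope.

(* Writing u = [a:b] and v = [c:d], the spreads of u u v, u v, v and u satisfy a
   three-term identity which, the form being multiplicative for the k-product, is
   a rational identity in a, b, c, d. For v = u^n it is the recursion of S_n. *)

Lemma kspread_mk (F : fieldType) (k : int) (p : F * F) (np : kdot k p p != 0) :
  kspread (mk_nnpoint np) = k%:~R * p.2 ^+ 2 / kdot k p p.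
Proof.
by case: p np => a b np; rewrite kspreadE /kdot /=; congr (_ / _); ring.
Qed.

Lemma kspread_mul_mul (F : fieldType) (k : int) (u v : nnpoint F k) :
  kspread (u * (u * v))%g =
  2 * (1 - 2 * kspread u) * kspread (u * v)%g - kspread v + 2 * kspread u.
Proof.
rewrite -[u]coordsK -[v]coordsK.
move: (coords_nonnull u) (coords_nonnull v).
case: (coords u) (coords v) => [a b] [c d] nu nv.
(* The group law is convertible to [nnpoint_mul], so products can be computed on arbitrary
   representatives. *)
have mulE : (mk_nnpoint nu * mk_nnpoint nv)%g = mk_nnpoint (kmul_nonnull nu nv).
  exact: nnpoint_mulE.
have mul2E : (mk_nnpoint nu * mk_nnpoint (kmul_nonnull nu nv))%g =
    mk_nnpoint (kmul_nonnull nu (kmul_nonnull nu nv)).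
  exact: nnpoint_mulE.
(* [kdot_kmul] factors each denominator into the forms of [u] and [v], so [field] needs only [nu]
   and [nv]. *)
rewrite mulE mul2E !kspread_mk !kdot_kmul.
move: nu nv {mulE mul2E}; rewrite /kdot /kmul /= => nu nv.
by field; rewrite nu nv.
Qed.

Lemma kspread1 (F : fieldType) (k : int) : kspread (1%g : nnpoint F k) = 0.
Proof.
by rewrite /kspread quadranceE /cross subrr expr0n mulr0 mul0r.
Qed.

Theorem theorem7 (F : fieldType) (k : int) (charF : 2%N \notin [pchar F])
    (k_neq0 : k%:~R != 0 :> F) (u : nnpoint F k) (s : F)
    (u_spread : kspread u = s) (n : nat) :
  kspread (u ^+ n)%g = (spread_poly F n).[s].
Proof.
(* The recursion has order two, so the induction carries two consecutive indices. *)
suff [] : kspread (u ^+ n)%g = (spread_poly F n).[s] /\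
          kspread (u ^+ n.+1)%g = (spread_poly F n.+1).[s] by [].
elim: n => [|n [IHn IHn1]]; first by rewrite expg0 kspread1 expg1 horner0 hornerX.
split=> //; rewrite 2!expgS kspread_mul_mul -expgS IHn IHn1 u_spread.
(* Simplifying also unfolds the inner [spread_poly F n.+1], which is folded back. *)
rewrite [spread_poly F n.+2]/= -/(spread_poly F n.+1).
by rewrite !hornerE.
Qed.
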